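(* BCP holds in $(\mathbb{H},d_\epsilon)$ for every $\epsilon >0$, whereas BCP does not hold in $(\mathbb{H},d_0)$.
   Context: The first Heisenberg group $\mathbb{H}$ is $\mathbb{R}^2\times\mathbb{R}$ with group law $(v,z)\cdot(v',z') := (v+v', z+z'+\omega(v,v')/2)$, where $\omega(v,v') := v_1v'_2-v_2v'_1$, and dilations $\delta_t(v,z) := (tv,t^2z)$, $t\ge 0$. A distance $d$ on $\mathbb{H}$ is homogeneous if it is left-invariant ($d(p\cdot q,p\cdot q')=d(q,q')$) and $d(\delta_t(p),\delta_t(q))=t\,d(p,q)$ for all $t>0$; by left-invariance it is determined by $d(0,\cdot)$ via $d(p,q)=d(0,p^{-1}\cdot q)$. The Korányi distance $d_0$ is the homogeneous distance on $\mathbb{H}$ given by $d_0(0,(v,z)) := (\|v\|^4+16z^2)^{1/4}$. For $\epsilon>0$, $d_\epsilon$ is the homogeneous distance on $\mathbb{H}$ given by $d_\epsilon(0,(v,z)) := (\epsilon^2\|v\|^2 + d_0(0,(v,z))^2)^{1/2}$. Here $\|\cdot\|$ is the Euclidean norm on $\mathbb{R}^2$. (It is known that these are indeed distances.) BCP: in a metric space, balls are closed balls $B(p,r)=\{q: d(p,q)\le r\}$, $0<r<\infty$ (a ball comes with its center and radius). A family $\mathcal{B}$ of balls is a Besicovitch family if the center of each $B\in\mathcal{B}$ belongs to no other $B'\in\mathcal{B}$, $B'\ne B$, and $\bigcap_{B\in\mathcal{B}}B\neq\emptyset$. The space satisfies the Besicovitch Covering Property (BCP) if there is a constant $C\ge1$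 such that $\operatorname{Card}\mathcal{B}\le C$ for every Besicovitch family $\mathcal{B}$ of balls. *)

(* Defs.v *)
From HB Require Import structures.
From mathcomp Require Import all_boot all_order all_algebra.
From mathcomp Require Import ring lra.
From mathcomp Require Import all_classical all_reals all_analysis.

Set Implicit Arguments.
Unset Strict Implicit.
Unset Printing Implicit Defensive.

Import Order.TTheory GRing.Theory Num.Theory.
Local Open Scope classical_set_scope.
Local Open Scope ring_scope.

(* The library's [closed_ball] is the closure of an open ball, which in a
   general metric space is smaller than the set below. *)
Definition cball {R : realType} {T : metricType R} (p : T) (r : R) : set T :=
  [set q | mdist p q <= r].

(* A ball is encoded as the pair (center, radius), since the subset alone need
   not determine them. *)
Definition besicovitch_family {R : realType} {T : metricType R}
    (F : set (T * R)) : Prop :=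
  [/\ forall B, F B -> 0 < B.2,
      forall B B', F B -> F B' -> B' <> B -> ~ cball B'.1 B'.2 B.1
    & \bigcap_(B in F) cball B.1 B.2 !=set0].

Definition BCP {R : realType} (T : metricType R) : Prop :=
  exists2 C : nat, (1 <= C)%N &
    forall F : set (T * R), besicovitch_family F -> (F #<= `I_C)%card.

Section Heisenberg.
Variable R : realType.

Definition heis : Type := ((R * R) * R)%type.

Implicit Types (v w : R * R) (p q : heis).

(* The library's norm on a product is the max norm. *)
Definition enorm v : R := Num.sqrt (v.1 ^+ 2 + v.2 ^+ 2).

Definition symp v w : R := v.1 * w.2 - v.2 * w.1.

Definition heis0 : heis := ((0, 0), 0).

Definition heis_mul p q : heis :=
  ((p.1.1 + q.1.1, p.1.2 + q.1.2), p.2 + q.2 + symp p.1 q.1 / 2).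

Definition heis_inv p : heis := ((- p.1.1, - p.1.2), - p.2).

Definition heis_dil (t : R) p : heis :=
  ((t * p.1.1, t * p.1.2), t ^+ 2 * p.2).

Definition koranyi_norm p : R :=
  (enorm p.1 ^+ 4 + 16 * p.2 ^+ 2) `^ (4^-1).

Definition koranyi_dist p q : R := koranyi_norm (heis_mul (heis_inv p) q).

Definition eps_norm (eps : R) p : R :=
  Num.sqrt (eps ^+ 2 * enorm p.1 ^+ 2 + koranyi_dist heis0 p ^+ 2).

Definition eps_dist (eps : R) p q : R :=
  eps_norm eps (heis_mul (heis_inv p) q).

Definition left_invariant (d : heis -> heis -> R) : Prop :=
  forall p q q', d (heis_mul p q) (heis_mul p q') = d q q'.

Definition dil_homogeneous (d : heis -> heis -> R) : Prop :=
  forall (t : R) p q, 0 < t -> d (heis_dil t p) (heis_dil t q) = t * d p q.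

Lemma heis_mulA : associative heis_mul.
Proof.
by move=> [[x y] z] [[x' y'] z'] [[x2 y2] z2]; rewrite /heis_mul /symp /=;
  congr ((_, _), _); field.
Qed.

Lemma heis_mul0p : left_id heis0 heis_mul.
Proof.
by move=> [[x y] z]; rewrite /heis_mul /symp /=; congr ((_, _), _); field.
Qed.

Lemma heis_mulVp : left_inverse heis0 heis_inv heis_mul.
Proof.
by move=> [[x y] z]; rewrite /heis_mul /symp /=; congr ((_, _), _); field.
Qed.

Lemma heis_invM p q : heis_inv (heis_mul p q) = heis_mul (heis_inv q) (heis_inv p).
Proof.
by case: p q => [[x y] z] [[x' y'] z']; rewrite /heis_mul /heis_inv /symp /=;
  congr ((_, _), _); field.
Qed.

Lemma heis_invK : involutive heis_inv.
Proof. by move=> [[x y] z]; rewrite /heis_inv /= !opprK. Qed.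

Lemma heis_mulpV : right_inverse heis0 heis_inv heis_mul.
Proof. by move=> p; rewrite -[X in heis_mul X _]heis_invK heis_mulVp. Qed.

Lemma heis_divM p q q' :
  heis_mul (heis_inv (heis_mul p q)) (heis_mul p q') = heis_mul (heis_inv q) q'.
Proof.
by rewrite heis_invM -heis_mulA (heis_mulA (heis_inv p)) heis_mulVp heis_mul0p.
Qed.

Lemma heis_dilM t p q :
  heis_mul (heis_inv (heis_dil t p)) (heis_dil t q) =
  heis_dil t (heis_mul (heis_inv p) q).
Proof.
by case: p q => [[x y] z] [[x' y'] z'];
  rewrite /heis_mul /heis_inv /heis_dil /symp /=; congr ((_, _), _); field.
Qed.

Lemma heis_mulV_split p q r : heis_mul (heis_inv p) r =
  heis_mul (heis_mul (heis_inv p) q) (heis_mul (heis_inv q) r).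
Proof.
by rewrite -heis_mulA (heis_mulA q) heis_mulpV heis_mul0p.
Qed.

Lemma heis_inv0 : heis_inv heis0 = heis0.
Proof. by rewrite /heis_inv /= !oppr0. Qed.

Lemma koranyi_dist0 p : koranyi_dist heis0 p = koranyi_norm p.
Proof. by rewrite /koranyi_dist heis_inv0 heis_mul0p. Qed.

Lemma eps_dist0 eps p : eps_dist eps heis0 p = eps_norm eps p.
Proof. by rewrite /eps_dist heis_inv0 heis_mul0p. Qed.

Lemma enorm_ge0 v : 0 <= enorm v. Proof. exact: sqrtr_ge0. Qed.

Lemma enorm_sqr v : enorm v ^+ 2 = v.1 ^+ 2 + v.2 ^+ 2.
Proof. by rewrite sqr_sqrtr// addr_ge0 ?sqr_ge0. Qed.

Lemma enorm_le v w : 0 <= v.1 <= w.1 -> 0 <= v.2 <= w.2 -> enorm v <= enorm w.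
Proof.
move=> /andP[v1 vw1] /andP[v2 vw2]; rewrite ler_sqrt ?addr_ge0 ?sqr_ge0//.
by apply: lerD; apply: lerXn2r => //; rewrite nnegrE//;
  [apply: le_trans vw1 | apply: le_trans vw2].
Qed.

Lemma enormD v w : enorm (v.1 + w.1, v.2 + w.2) <= enorm v + enorm w.
Proof.
have vw0 : 0 <= enorm v * enorm w by rewrite mulr_ge0 ?enorm_ge0.
have cs : v.1 * w.1 + v.2 * w.2 <= enorm v * enorm w.
  apply: (le_trans (ler_norm _)); rewrite -(@ler_pXn2r _ 2) ?nnegrE//.
  rewrite real_normK ?num_real// exprMn !enorm_sqr.
  have := sqr_ge0 (v.1 * w.2 - v.2 * w.1); nra.
rewrite -(@ler_pXn2r _ 2) ?nnegrE ?enorm_ge0 ?addr_ge0 ?enorm_ge0//.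
by rewrite sqrrD !enorm_sqr /= mulr2n; lra.
Qed.

Lemma koranyi_norm_ge0 p : 0 <= koranyi_norm p. Proof. exact: powR_ge0. Qed.

Lemma koranyi_norm_sqr p : koranyi_norm p ^+ 2 = enorm (enorm p.1 ^+ 2, 4 * p.2).
Proof.
have h : 0 <= enorm p.1 ^+ 4 + 16 * p.2 ^+ 2.
  apply: addr_ge0; first exact/exprn_ge0/enorm_ge0.
  by apply: mulr_ge0; rewrite ?sqr_ge0.
rewrite /koranyi_norm -powR_mulrn ?powR_ge0// -powRrM.
have -> : 4^-1 * 2 = 2^-1 :> R by field.
rewrite powR12_sqrt// {2}/enorm /= -exprM; congr (Num.sqrt (_ + _)); ring.
Qed.

Lemma enorm_mul v w :
  enorm (v.1 * w.1 + v.2 * w.2, symp v w) = enorm v * enorm w.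
Proof.
rewrite /enorm /= -sqrtrM ?addr_ge0 ?sqr_ge0//; congr Num.sqrt.
rewrite /symp; ring.
Qed.

Lemma enorm_le_koranyi p : enorm p.1 <= koranyi_norm p.
Proof.
rewrite -(@ler_pXn2r _ 2) ?nnegrE ?enorm_ge0 ?koranyi_norm_ge0//.
rewrite koranyi_norm_sqr -(@ler_pXn2r _ 2) ?nnegrE ?enorm_ge0 ?sqr_ge0//.
by rewrite [leRHS]enorm_sqr lerDl sqr_ge0.
Qed.

Lemma koranyi_normD p q :
  koranyi_norm (heis_mul p q) <= koranyi_norm p + koranyi_norm q.
Proof.
have kp := koranyi_norm_ge0 p; have kq := koranyi_norm_ge0 q.
rewrite -(@ler_pXn2r _ 2) ?nnegrE ?koranyi_norm_ge0 ?addr_ge0//.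
rewrite sqrrD !koranyi_norm_sqr.
pose u := (p.1.1 * q.1.1 + p.1.2 * q.1.2, symp p.1 q.1).
pose A : R * R := (enorm p.1 ^+ 2, 4 * p.2).
pose B : R * R := (enorm q.1 ^+ 2, 4 * q.2).
have -> : (enorm (heis_mul p q).1 ^+ 2, 4 * (heis_mul p q).2) =
  ((A.1 + B.1) + (u.1 + u.1), (A.2 + B.2) + (u.2 + u.2)).
  by rewrite /A /B /u /= !enorm_sqr /=; congr (_, _); field.
have h1 := enormD (A.1 + B.1, A.2 + B.2) (u.1 + u.1, u.2 + u.2).
have h2 := enormD A B; have h3 := enormD u u.
have h4 : enorm u <= koranyi_norm p * koranyi_norm q.
  by rewrite enorm_mul ler_pM ?enorm_ge0 ?enorm_le_koranyi.
move: h1 h2 h3 h4; rewrite /A /B /= mulr2n; lra.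
Qed.

Lemma enorm_inv v : enorm (- v.1, - v.2) = enorm v.
Proof. by rewrite /enorm /= !sqrrN. Qed.

Lemma enorm0 v : enorm v = 0 -> v = (0, 0).
Proof.
case: v => x y /eqP; rewrite sqrtr_eq0 /= => h.
have hx := sqr_ge0 x; have hy := sqr_ge0 y.
have /eqP : x ^+ 2 = 0 by lra.
have /eqP : y ^+ 2 = 0 by lra.
by rewrite !sqrf_eq0 => /eqP -> /eqP ->.
Qed.

Lemma koranyi_norm0 : koranyi_norm heis0 = 0.
Proof.
by rewrite /koranyi_norm /enorm /= !expr0n /= addr0 sqrtr0 expr0n mulr0 addr0
  powR0// invr_eq0 pnatr_eq0.
Qed.

Lemma koranyi_norm_eq0 p : koranyi_norm p = 0 -> p = heis0.
Proof.
move=> h; have : koranyi_norm p ^+ 2 = 0 by rewrite h expr0n.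
rewrite koranyi_norm_sqr => /enorm0 [].
move=> /eqP; rewrite sqrf_eq0 => /eqP /enorm0 h1 /eqP.
rewrite mulf_eq0 pnatr_eq0 /= => /eqP h2.
by case: p h1 h2 {h} => v z /= -> ->.
Qed.

Lemma koranyi_norm_inv p : koranyi_norm (heis_inv p) = koranyi_norm p.
Proof. by rewrite /koranyi_norm /= enorm_inv sqrrN. Qed.

Lemma enorm_dil t v : 0 <= t -> enorm (t * v.1, t * v.2) = t * enorm v.
Proof.
move=> t0; rewrite /enorm /= !exprMn -mulrDr sqrtrM ?sqr_ge0//.
by rewrite sqrtr_sqr ger0_norm.
Qed.

Lemma koranyi_norm_dil t p : 0 <= t ->
  koranyi_norm (heis_dil t p) = t * koranyi_norm p.
Proof.
move=> t0; apply/eqP.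
rewrite -(@eqrXn2 _ 2) ?mulr_ge0 ?koranyi_norm_ge0// exprMn !koranyi_norm_sqr /=.
rewrite enorm_dil// -[X in _ == X]enorm_dil ?sqr_ge0//=; apply/eqP.
by congr (enorm (_, _)); ring.
Qed.

Lemma eps_normE eps p : eps_norm eps p = enorm (`|eps| * enorm p.1, koranyi_norm p).
Proof.
by rewrite /eps_norm koranyi_dist0 {2}/enorm /= exprMn real_normK ?num_real.
Qed.

Lemma eps_normD eps p q :
  eps_norm eps (heis_mul p q) <= eps_norm eps p + eps_norm eps q.
Proof.
rewrite !eps_normE; apply: le_trans (enormD _ _); apply: enorm_le => /=.
  rewrite mulr_ge0 ?enorm_ge0 ?normr_ge0//= -mulrDr ler_wpM2l//.
  exact: enormD.
by rewrite koranyi_norm_ge0 koranyi_normD.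
Qed.

Lemma eps_norm0 eps : eps_norm eps heis0 = 0.
Proof.
rewrite eps_normE koranyi_norm0 /enorm /=.
by rewrite !(expr0n, addr0, sqrtr0, mulr0, mulr0n, mulr1n) /= ?(addr0, sqrtr0).
Qed.

Lemma eps_norm_eq0 eps p : eps_norm eps p = 0 -> p = heis0.
Proof. by rewrite eps_normE => /enorm0 [_ /koranyi_norm_eq0]. Qed.

Lemma eps_norm_inv eps p : eps_norm eps (heis_inv p) = eps_norm eps p.
Proof. by rewrite !eps_normE koranyi_norm_inv /= enorm_inv. Qed.

Lemma eps_norm_dil eps t p : 0 <= t ->
  eps_norm eps (heis_dil t p) = t * eps_norm eps p.
Proof.
move=> t0; rewrite !eps_normE -enorm_dil// koranyi_norm_dil//= enorm_dil//.
by rewrite mulrCA.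
Qed.

Lemma heis_mulV_eq0 p q : heis_mul (heis_inv p) q = heis0 -> p = q.
Proof.
case: p q => [[x y] z] [[x' y'] z'] [] /= h1 h2; rewrite /symp /= => h3.
have e1 : x = x' by lra.
have e2 : y = y' by lra.
by subst x' y'; congr ((_, _), _); lra.
Qed.

Section dist_of_norm.
Variable N : heis -> R.
Hypotheses (N0 : N heis0 = 0) (N_eq0 : forall p, N p = 0 -> p = heis0)
  (NV : forall p, N (heis_inv p) = N p)
  (ND : forall p q, N (heis_mul p q) <= N p + N q)
  (Ndil : forall t p, 0 <= t -> N (heis_dil t p) = t * N p).

Let d p q := N (heis_mul (heis_inv p) q).

Lemma norm_distxx p : d p p = 0.
Proof. by rewrite /d heis_mulVp N0. Qed.

Lemma norm_dist_positivity p q : d p q = 0 -> p = q.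
Proof. by move=> /N_eq0 /heis_mulV_eq0. Qed.

Lemma norm_dist_sym p q : d p q = d q p.
Proof. by rewrite /d -NV heis_invM heis_invK. Qed.

Lemma norm_dist_triangle q p r : d p r <= d p q + d q r.
Proof. by rewrite /d (heis_mulV_split _ q) ND. Qed.

Lemma norm_dist_left_invariant : left_invariant d.
Proof. by move=> p q q'; rewrite /d heis_divM. Qed.

Lemma norm_dist_homogeneous : dil_homogeneous d.
Proof. by move=> t p q t0; rewrite /d heis_dilM Ndil// ltW. Qed.

End dist_of_norm.

Lemma koranyi_dist_left_invariant : left_invariant koranyi_dist.
Proof. exact: norm_dist_left_invariant. Qed.

Lemma koranyi_dist_homogeneous : dil_homogeneous koranyi_dist.
Proof. exact/norm_dist_homogeneous/koranyi_norm_dil. Qed.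

Lemma eps_dist_left_invariant eps : left_invariant (eps_dist eps).
Proof. exact: norm_dist_left_invariant. Qed.

Lemma eps_dist_homogeneous eps : dil_homogeneous (eps_dist eps).
Proof. exact/norm_dist_homogeneous/eps_norm_dil. Qed.

End Heisenberg.

(* Two copies of the carrier, so that each can bear its own metric. *)
Definition heis_koranyi (R : realType) : Type := heis R.
Definition heis_eps (R : realType) (eps : R) : Type := heis R.

HB.instance Definition _ (R : realType) :=
  Choice.copy (heis_koranyi R) ((R * R) * R)%type.
HB.instance Definition _ (R : realType) (eps : R) :=
  Choice.copy (heis_eps eps) ((R * R) * R)%type.

HB.instance Definition _ (R : realType) :=
  @isMetric.Build R (heis_koranyi R) (@koranyi_dist R)
    (norm_distxx (@koranyi_norm0 R))
    (norm_dist_positivity (@koranyi_norm_eq0 R))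
    (norm_dist_sym (@koranyi_norm_inv R))
    (norm_dist_triangle (@koranyi_normD R)).

HB.instance Definition _ (R : realType) (eps : R) :=
  @isMetric.Build R (heis_eps eps) (@eps_dist R eps)
    (norm_distxx (@eps_norm0 R eps))
    (norm_dist_positivity (@eps_norm_eq0 R eps))
    (norm_dist_sym (@eps_norm_inv R eps))
    (norm_dist_triangle (@eps_normD R eps)).

Lemma mdist_koranyiE (R : realType) (p q : heis_koranyi R) :
  mdist p q = koranyi_dist p q.
Proof. by []. Qed.

Lemma mdist_epsE (R : realType) (eps : R) (p q : heis_eps eps) :
  mdist p q = eps_dist eps p q.
Proof. by []. Qed.

(* Main.v *)
(* A Besicovitch family whose balls share the origin gives points with
   d(p, q) > max (N p) (N q) for p <> q, and homogeneity reduces the question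
   to the sign of the first variation of N ^ 2 (or of N ^ 4) at p when p is
   left-translated by the inverse of a much smaller point q.

   For the Koranyi distance, near the vertical axis this variation is governed
   by the area form, which is positive as soon as the horizontal part of q is
   turned counterclockwise from that of p: the points dil (t ^ i) ((1, i), K),
   with K large and t small, give arbitrarily large families.

   For d_eps, the square of the norm is f(|v| ^ 2, 4 z) with the convex function
   f(X, Y) = eps ^ 2 X + |(X, Y)|, and the term eps ^ 2 |v| ^ 2 adds a negative
   contribution proportional to the inner product of the horizontal parts. It
   beats the area form when the horizontal directions of p and q are close, so
   that d(p, q) <= N p if q is much smaller than p and both lie in a narrow cone.
   At comparable scales the same holds when the projections of p and q to the
   unit sphere are close. A finite coloring of the group then separates the
   centers of any Besicovitch family. *)
Require Import Defs.
From mathcomp Require Import all_boot all_order all_algebra.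
From mathcomp Require Import ring lra.
From mathcomp Require Import all_classical all_reals all_analysis.

Set Implicit Arguments.
Unset Strict Implicit.
Unset Printing Implicit Defensive.

Import Order.TTheory GRing.Theory Num.Theory.
Local Open Scope ring_scope.

(** * The Korányi distance: arbitrarily large Besicovitch families *)

Section Koranyi.
Variable R : realType.
Implicit Types (p q : heis R) (x y K tau : R).

Lemma koranyi_distC p q : koranyi_dist p q = koranyi_dist q p.
Proof. exact/norm_dist_sym/koranyi_norm_inv. Qed.

Lemma koranyi_norm_lt p q :
  (p.1.1 ^+ 2 + p.1.2 ^+ 2) ^+ 2 + 16 * p.2 ^+ 2 <
    (q.1.1 ^+ 2 + q.1.2 ^+ 2) ^+ 2 + 16 * q.2 ^+ 2 ->
  koranyi_norm p < koranyi_norm q.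
Proof.
have E (r : heis R) : enorm r.1 ^+ 4 = (r.1.1 ^+ 2 + r.1.2 ^+ 2) ^+ 2.
  by rewrite -(enorm_sqr r.1) -exprM.
have nn (r : heis R) : 0 <= (r.1.1 ^+ 2 + r.1.2 ^+ 2) ^+ 2 + 16 * r.2 ^+ 2.
  by apply: addr_ge0; [exact: sqr_ge0 | apply: mulr_ge0 => //; exact: sqr_ge0].
move=> lt_pq; rewrite /koranyi_norm !E; apply: gt0_ltr_powR; rewrite ?nnegrE ?nn//.
Qed.

(* Since the Koranyi sphere is flat to fourth order at its poles, a small step
   from [((1, x), K)] whose horizontal direction is turned counterclockwise
   increases the norm: the vertical gain [8 * K * tau] beats the horizontal
   loss [4 * tau * (1 + x ^+ 2) * (1 + x * y)]. *)
Lemma koranyi_dist_gt x y K tau : 0 <= x -> 1 <= y - x ->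
  (1 + x ^+ 2) * (1 + x * y) <= K -> 0 < tau -> 4 * K * tau <= 1 ->
  koranyi_norm ((1, x), K) <
    koranyi_dist ((1, x), K) (heis_dil tau ((1, y), K)).
Proof.
move=> x0 xy hK tau0 tauK; apply: koranyi_norm_lt => /=; rewrite /symp /=.
have y0 : 0 <= y by lra.
have xy0 : 0 <= x * y by exact: mulr_ge0.
have x20 := sqr_ge0 x.
have K1 : 1 <= K.
  by apply: le_trans hK; rewrite -[leLHS]mulr1 ler_pM//; lra.
set A := 1 + x ^+ 2; set s := 1 + x * y.
have -> : (- (1) + tau * 1) ^+ 2 + (- x + tau * y) ^+ 2 =
  A - 2 * tau * s + tau ^+ 2 * (1 + y ^+ 2) by rewrite /A /s; ring.
have -> : - K + tau ^+ 2 * K + (- (1) * (tau * y) - - x * (tau * 1)) / 2 =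
  - (K + tau * ((y - x) / 2 - tau * K)) by field.
rewrite sqrrN.
(* As [y - x >= 1] and [tau * K <= 1 / 4], the height grows by at least [tau / 4]; sixteen times the
   square then gains at least [8 * K * tau]. *)
have v : K + tau / 4 <= K + tau * ((y - x) / 2 - tau * K).
  rewrite lerD2l ler_wpM2l//; lra.
have v2 : (K + tau / 4) ^+ 2 <= (K + tau * ((y - x) / 2 - tau * K)) ^+ 2.
  rewrite lerXn2r ?nnegrE//; lra.
have h : A ^+ 2 - 4 * tau * (A * s) <=
    (A - 2 * tau * s + tau ^+ 2 * (1 + y ^+ 2)) ^+ 2.
  set B := tau ^+ 2 * (1 + y ^+ 2).
  have B0 : 0 <= B by rewrite mulr_ge0 ?addr_ge0 ?sqr_ge0.
  have AB : 0 <= A * B by rewrite mulr_ge0// /A; lra.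
  have := sqr_ge0 (- 2 * tau * s + B).
  have -> : (A - 2 * tau * s + B) ^+ 2 =
    A ^+ 2 - 4 * tau * (A * s) + 2 * (A * B) + (- 2 * tau * s + B) ^+ 2 by ring.
  lra.
have As : tau * (A * s) <= tau * K by rewrite ler_wpM2l// ltW.
have tK : 0 < tau * K by rewrite mulr_gt0//; lra.
have t2 := sqr_ge0 tau.
rewrite expr1n -/A; nra.
Qed.

(** Norms decrease along the sequence of centers, so a distance exceeding the norm of the earlier
    point also exceeds that of the later one. *)
Lemma koranyi_norm_dil_lt x y K tau : 1 <= K -> (1 + y ^+ 2) ^+ 2 <= K ->
  0 < tau -> 4 * K * tau <= 1 ->
  koranyi_norm (heis_dil tau ((1, y), K)) < koranyi_norm ((1, x), K).
Proof.
move=> K1 hy tau0 tauK; apply: koranyi_norm_lt => /=.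
have -> : ((tau * 1) ^+ 2 + (tau * y) ^+ 2) ^+ 2 + 16 * (tau ^+ 2 * K) ^+ 2 =
  tau ^+ 4 * ((1 + y ^+ 2) ^+ 2 + 16 * K ^+ 2) by ring.
have K2 : K <= K ^+ 2 by rewrite expr2 ler_peMl//; lra.
have t1 : tau <= 2^-1 by nra.
have t4 : tau ^+ 4 <= 2^-1.
  have := lerXn2r 4 _ _ t1; rewrite !nnegrE => /(_ (ltW tau0)) h.
  by apply: le_trans (h _) _; lra.
have h : tau ^+ 4 * ((1 + y ^+ 2) ^+ 2 + 16 * K ^+ 2) <= 2^-1 * (17 * K ^+ 2).
  apply: ler_pM => //; [exact/exprn_ge0/ltW| |lra].
  by apply: addr_ge0; [exact: sqr_ge0 | apply: mulr_ge0 => //; exact: sqr_ge0].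
have := sqr_ge0 (1 ^+ 2 + x ^+ 2); lra.
Qed.

Lemma koranyi_not_BCP : ~ BCP (heis_koranyi R).
Proof.
move=> [n n1 bcp].
(* [K] dominates [(1 + x ^+ 2) * (1 + x * y)] for all slopes up to [n], and [t] gives
   [4 * K * t ^+ k <= 1] for every [k >= 1]. *)
pose K : R := (1 + n%:R ^+ 2) ^+ 2.
pose t : R := (4 * K)^-1.
have n0 : 0 <= n%:R :> R by [].
have K1 : 1 <= K.
  by have := sqr_ge0 (n%:R : R); rewrite /K => h; rewrite expr_ge1//; lra.
have t0 : 0 < t by rewrite invr_gt0; lra.
have t1 : t <= 1 by rewrite invf_le1; lra.
have tK : 4 * K * t <= 1 by rewrite mulfV//; lra.
pose c (i : nat) : heis R := ((1, i%:R), K).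
pose P (i : nat) : heis R := heis_dil (t ^+ i) (c i).
have PE i j : (i < j)%N ->
    P j = heis_dil (t ^+ i) (heis_dil (t ^+ (j - i)) (c j)).
  move=> ij; rewrite /P -{1}(subnKC (ltnW ij)) exprD /heis_dil /c /=.
  by congr ((_, _), _); ring.
have tj i j : (i < j)%N -> 0 < t ^+ (j - i) /\ 4 * K * t ^+ (j - i) <= 1.
  move=> ij; split; first exact: exprn_gt0.
  apply: le_trans tK; rewrite ler_wpM2l//; first lra.
  rewrite -[leRHS]expr1 ler_wiXn2l//; [exact: ltW | by rewrite subn_gt0].
have sep i j : (i < j <= n)%N ->
    koranyi_norm (P i) < koranyi_dist (P i) (P j) /\
    koranyi_norm (P j) < koranyi_norm (P i).
  move=> /andP[ij jn]; have [tji0 tjiK] := tj _ _ ij.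
  have ti0 : 0 < t ^+ i by exact: exprn_gt0.
  have ijR : i.+1%:R <= j%:R :> R by rewrite ler_nat.
  have jnR : j%:R <= n%:R :> R by rewrite ler_nat.
  have i0 : 0 <= i%:R :> R by [].
  rewrite -natr1 in ijR.
  have jn2 : (j%:R : R) ^+ 2 <= n%:R ^+ 2 by rewrite lerXn2r ?nnegrE.
  rewrite (PE _ _ ij) /P koranyi_dist_homogeneous// !koranyi_norm_dil;
    try exact: ltW.
  rewrite !ltr_pM2l//; split.
    apply: koranyi_dist_gt => //; first lra.
    by rewrite /K [leRHS]expr2 ler_pM//; nra.
  rewrite -koranyi_norm_dil ?ltW//; apply: koranyi_norm_dil_lt => //.
  by rewrite /K lerXn2r ?nnegrE; have := sqr_ge0 (j%:R : R); lra.
have far i j : (i <= n)%N -> (j <= n)%N -> i != j ->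
    koranyi_norm (P i) < koranyi_dist (P i) (P j).
  move=> im jm; rewrite neq_ltn => /orP[ij|ji].
    by have [|] := sep i j; rewrite ?ij.
  have [|h1 h2] := sep j i; first by rewrite ji.
  by rewrite koranyi_distC; apply: lt_trans h1.
(* Each ball has the origin on its boundary; the indices 0 to [n] give one ball too many. *)
pose b (i : nat) : heis_koranyi R * R := (P i, koranyi_norm (P i)).
have b_inj : {in `I_n.+1 &, injective b}.
  move=> i j; rewrite !inE /= => im jm /(congr1 fst) /= e1.
  apply: contrapT => /eqP ij.
  have := far _ _ im jm ij; rewrite -e1 /koranyi_dist heis_mulVp.
  by rewrite koranyi_norm0 ltNge koranyi_norm_ge0.
have bF : besicovitch_family (b @` `I_n.+1)%classic.
  split.
  - move=> _ [i /= im <-] /=; rewrite lt_neqAle koranyi_norm_ge0 andbT eq_sym.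
    apply/eqP => /koranyi_norm_eq0 [] /eqP; rewrite mulr1 => /eqP/esym h.
    by have := exprn_gt0 i t0; rewrite h ltxx.
  - move=> _ _ [i /= im <-] [j /= jm <-] ne; rewrite /cball/= mdist_koranyiE.
    apply/negP; rewrite -ltNge; apply: far => //.
    by apply/eqP => ij; apply: ne; rewrite ij.
  - exists (heis0 R : heis_koranyi R) => _ [i /= im <-]; rewrite /cball/=.
    rewrite mdist_koranyiE koranyi_distC.
    by rewrite koranyi_dist0.
have := bcp _ bF.
by rewrite (card_le_eql (inj_card_eq b_inj)) card_le_II ltnn.
Qed.

End Koranyi.

(** * Decrease of a convex gauge under a small step *)

Section ConvexGauge.
Variable R : realType.
Implicit Types (A B X Y Z U s t e : R).

Definition gauge e X Y : R := e * X + enorm (X, Y).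

Lemma enorm_sqrE X Y : enorm (X, Y) ^+ 2 = X ^+ 2 + Y ^+ 2.
Proof. exact: enorm_sqr. Qed.

Lemma norm_le_enorm X Y : `|Y| <= enorm (X, Y).
Proof.
rewrite -(@ler_pXn2r _ 2) ?nnegrE ?enorm_ge0// enorm_sqrE real_normK ?num_real//.
by rewrite lerDr sqr_ge0.
Qed.

Lemma enorm_le_norm X Y : 0 <= X -> enorm (X, Y) <= X + `|Y|.
Proof.
move=> X0; rewrite -(@ler_pXn2r _ 2) ?nnegrE ?enorm_ge0 ?addr_ge0//.
rewrite enorm_sqrE sqrrD real_normK ?num_real//.
by have := mulr_ge0 X0 (normr_ge0 Y); rewrite mulr2n; lra.
Qed.

(* The hypothesis is [enorm (X, Y)] times the derivative of the convex function
   [gauge e] at [(X, Y)] in the direction of [(A, Z)]. *)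
Lemma gauge_le e X Y A Z : 0 <= e -> 0 <= A ->
  0 <= (e * enorm (X, Y) + X) * (A - X) + Y * (Z - Y) ->
  gauge e X Y <= gauge e A Z.
Proof.
move=> e0 A0; rewrite /gauge; set r := enorm (X, Y); set r' := enorm (A, Z).
have r0 : 0 <= r by exact: enorm_ge0.
have r'0 : 0 <= r' by exact: enorm_ge0.
have rE : r ^+ 2 = X ^+ 2 + Y ^+ 2 by exact: enorm_sqrE.
have r'E : r' ^+ 2 = A ^+ 2 + Z ^+ 2 by exact: enorm_sqrE.
have cs : X * A + Y * Z <= r * r'.
  apply: le_trans (ler_norm _) _; rewrite -(@ler_pXn2r _ 2) ?nnegrE ?mulr_ge0//.
  rewrite real_normK ?num_real// exprMn rE r'E -subr_ge0.
  by rewrite (_ : _ - _ = (X * Z - Y * A) ^+ 2) ?sqr_ge0//; ring.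
have [r_eq0|rn0] := eqVneq r 0; last first.
  have rp : 0 < r by rewrite lt_neqAle eq_sym rn0.
  move=> h; rewrite -(ler_pM2l rp) -subr_ge0; apply: le_trans h _.
  rewrite -subr_ge0.
  rewrite (_ : _ - _ = r * r' - (X * A + Y * Z) + (X ^+ 2 + Y ^+ 2 - r ^+ 2)).
    by rewrite rE; lra.
  by ring.
have := enorm0 r_eq0 => -[-> ->] _; rewrite r_eq0 mulr0 addr0.
by rewrite addr_ge0// mulr_ge0.
Qed.

(** For A = |v|^2, B = |w|^2, s = 2 <v, w> and t = 2 omega(v, w), the last hypothesis is Lagrange's
    identity and [A + B - s] is |v - w|^2. *)
Lemma step_sqr_ge0 A B s t : 0 <= A -> 0 <= B -> 0 <= s ->
  s ^+ 2 + t ^+ 2 = 4 * A * B -> 0 <= A + B - s.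
Proof.
move=> A0 B0 s0 stE; rewrite subr_ge0 -(@ler_pXn2r _ 2) ?nnegrE ?addr_ge0//.
by have := sqr_ge0 (A - B); have := sqr_ge0 t; nra.
Qed.

(** Near the positive vertical axis. In the criterion of [gauge_le], with (X, Y) the new point and r
    its norm, [e * r * s] pays for the rotation term [Y * t], and the loss of height [Y * U] pays
    for [(e * r + X) * B]. *)
Lemma gauge_step_pole e dl A B Z U s t : 0 < e ->
  0 <= A -> 0 <= B -> 0 <= s ->
  s ^+ 2 + t ^+ 2 = 4 * A * B -> 
  0 < dl -> 8 * dl <= 1 -> (2 * e + 1) * dl <= 1 ->
  `|t| <= e * s -> A <= dl * Z -> B <= dl * U -> 8 * U <= Z ->
  gauge e (A + B - s) (Z - U + t) <= gauge e A Z.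
Proof.
move=> e0 A0 B0 s0 stE dl0 dl8 dle ts AZ BU UZ; 
have X0 := step_sqr_ge0 A0 B0 s0 stE.
have U0 : 0 <= U by rewrite -(pmulr_rge0 _ dl0); lra.
apply: gauge_le => //; first exact: ltW.
have tl : `|t| <= A + B.
  rewrite -(@ler_pXn2r _ 2) ?nnegrE ?addr_ge0// real_normK ?num_real//.
  by have := sqr_ge0 (A - B); have := sqr_ge0 s; nra.
have dU : dl * U <= U / 8 by nra.
have dZ : dl * Z <= Z / 8 by nra.
have tN := ler_norm t; have tN' := ler_norm (- t); rewrite normrN in tN'.
set X := A + B - s; set Y := Z - U + t.
have YZ : Z / 2 <= Y by rewrite /Y; lra.
have XY : X <= Y by rewrite /X; lra.
have Y0 : 0 <= Y by lra.
have rY : Y <= enorm (X, Y) by have := norm_le_enorm X Y; rewrite ger0_norm.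
have r2Y : enorm (X, Y) <= 2 * Y.
  by have := enorm_le_norm Y X0; rewrite (ger0_norm Y0); lra.
set r := enorm (X, Y) in rY r2Y *.
rewrite (_ : A - X = s - B); last by rewrite /X; ring.
rewrite (_ : Z - Y = U - t); last by rewrite /Y; ring.
have r0 : 0 <= r by lra.
have h1 : Y * t <= r * (e * s).
  apply: le_trans (_ : r * `|t| <= _); last exact: ler_wpM2l.
  by apply: le_trans (ler_wpM2l Y0 tN) _; exact: ler_wpM2r.
have h2 : (e * r + X) * B <= (2 * e + 1) * Y * B.
  by apply: ler_wpM2r => //; nra.
have h3 : (2 * e + 1) * Y * B <= Y * U.
  rewrite -mulrA mulrCA ler_wpM2l//.
  apply: le_trans (_ : (2 * e + 1) * (dl * U) <= _).
    by rewrite ler_wpM2l//; lra.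
  by rewrite mulrA -[leRHS]mul1r ler_wpM2r.
have h4 : 0 <= X * s by rewrite mulr_ge0.
by nra.
Qed.

(** Away from the axis the inner product pays for everything: [|t| <= s] forces
    [2 * A * B <= s ^+ 2], hence [B <= sg * s], and [|U|] is at most [B / dl]. *)
Lemma gauge_step_equator e dl sg A B Z U s t : 0 < e ->
  0 <= A -> 0 <= B -> 0 <= s ->
  s ^+ 2 + t ^+ 2 = 4 * A * B -> 
  0 < dl -> 0 < sg -> 2 * sg <= 1 ->
  4 * sg <= dl * e -> `|t| <= s ->
  4 * `|t| <= e * s -> dl * `|U| <= B -> B <= sg ^+ 2 * A ->
  gauge e (A + B - s) (Z - U + t) <= gauge e A Z.
Proof.
move=> e0 A0 B0 s0 stE dl0 sg0 sg2 sgdl ts1 ts UB BA; 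
have X0 := step_sqr_ge0 A0 B0 s0 stE.
apply: gauge_le => //; first exact: ltW.
set X := A + B - s; set Y := Z - U + t.
have rY : `|Y| <= enorm (X, Y) by exact: norm_le_enorm.
set r := enorm (X, Y) in rY *.
have r0 : 0 <= r by exact: enorm_ge0.
rewrite (_ : A - X = s - B); last by rewrite /X; ring.
rewrite (_ : Z - Y = U - t); last by rewrite /Y; ring.
have Bs : B <= sg * s.
  rewrite -(@ler_pXn2r _ 2) ?nnegrE ?mulr_ge0//; last exact: ltW.
  have h1 : B ^+ 2 <= sg ^+ 2 * (A * B).
    by rewrite mulrA expr2 ler_wpM2r.
  have h2 : t ^+ 2 <= s ^+ 2.
    by rewrite -(real_normK (num_real t)) ler_pXn2r ?nnegrE.
  rewrite exprMn; apply: le_trans h1 _; rewrite ler_wpM2l ?sqr_ge0//.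
  by have := sqr_ge0 s; lra.
have Us : `|U| <= e / 4 * s.
  rewrite -(ler_pM2l dl0); apply: le_trans UB _; apply: le_trans Bs _.
  rewrite mulrA ler_wpM2r//; lra.
have h1 : `|Y * (U - t)| <= r * (e / 2 * s).
  rewrite normrM ler_pM//; apply: le_trans (ler_normB _ _) _; lra.
have h2 := ler_norm (- (Y * (U - t))); rewrite normrN in h2.
have h3 : (e * r + X) * (s / 2) <= (e * r + X) * (s - B).
  apply: ler_wpM2l; first by rewrite addr_ge0// mulr_ge0// ltW.
  have := ler_wpM2r s0 sg2; lra.
have h4 : 0 <= X * s by rewrite mulr_ge0.
lra.
Qed.

Lemma gaugeN e X Y : gauge e X (- Y) = gauge e X Y.
Proof. by rewrite /gauge /enorm /= sqrrN. Qed.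

End ConvexGauge.

(** * The distances d_eps: points at very different scales *)

Section EpsilonDistance.
Variables (R : realType) (eps : R).
Hypothesis eps0 : 0 < eps.
Implicit Types (v w : R * R) (p q : heis R) (h k L : R).
Local Notation N := (eps_norm eps).
Local Notation d := (eps_dist eps).

Definition dot v w : R := v.1 * w.1 + v.2 * w.2.

Lemma eps_distC p q : d p q = d q p.
Proof. exact/norm_dist_sym/eps_norm_inv. Qed.

Lemma eps_norm_ge0 p : 0 <= N p. Proof. exact: sqrtr_ge0. Qed.

Lemma eps_norm_sqr p : N p ^+ 2 = gauge (eps ^+ 2) (dot p.1 p.1) (4 * p.2).
Proof.
rewrite sqr_sqrtr; last first.
  by apply: addr_ge0; rewrite ?sqr_ge0// mulr_ge0 ?sqr_ge0.
by rewrite koranyi_dist0 koranyi_norm_sqr enorm_sqr.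
Qed.

Lemma eps_dist_sqr p q : d p q ^+ 2 =
  gauge (eps ^+ 2) (dot p.1 p.1 + dot q.1 q.1 - 2 * dot p.1 q.1)
    (4 * p.2 - 4 * q.2 + 2 * symp p.1 q.1).
Proof.
rewrite eps_norm_sqr -gaugeN; congr (gauge _ _ _); rewrite /dot /symp /=.
  by ring.
by rewrite /symp /=; field.
Qed.

Lemma dot_ge0 v : 0 <= dot v v.
Proof. by rewrite addr_ge0// -expr2 sqr_ge0. Qed.

Lemma eps_norm_sqr_bounds p :
  [/\ eps ^+ 2 * dot p.1 p.1 <= N p ^+ 2, 4 * `|p.2| <= N p ^+ 2 &
      N p ^+ 2 <= (eps ^+ 2 + 1) * dot p.1 p.1 + 4 * `|p.2|].
Proof.
have A0 := dot_ge0 p.1; rewrite eps_norm_sqr /gauge.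
have r0 := enorm_ge0 (dot p.1 p.1, 4 * p.2).
have h1 := norm_le_enorm (dot p.1 p.1) (4 * p.2).
have h2 := enorm_le_norm (4 * p.2) A0.
have E : `|4 * p.2| = 4 * `|p.2| by rewrite normrM ger0_norm.
have eA : 0 <= eps ^+ 2 * dot p.1 p.1 by rewrite mulr_ge0 ?sqr_ge0.
by rewrite E in h1 h2; split; lra.
Qed.

(* The inequality [dot v v <= dl * `|z|] defines a cone around the vertical axis,
   in which the decrease of the height absorbs [dot q.1 q.1]; outside it, [q.2]
   is negligible against [dot p.1 q.1]. *)
Lemma eps_dist_far : exists dl kp T : R, [/\ 0 < kp, 0 < T <= 1 &
  forall p q, (dot p.1 p.1 <= dl * `|p.2|) = (dot q.1 q.1 <= dl * `|q.2|) ->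
    (0 <= p.2) = (0 <= q.2) -> 0 <= dot p.1 q.1 ->
    `|symp p.1 q.1| <= kp * dot p.1 q.1 ->
    N q ^+ 2 <= T * N p ^+ 2 -> d p q <= N p].
Proof.
set e := eps ^+ 2; have e0 : 0 < e by exact: exprn_gt0.
pose dl : R := (8 * (2 * e + 1))^-1.
have dl0 : 0 < dl by rewrite invr_gt0; lra.
have dlE : 8 * (2 * e + 1) * dl = 1 by rewrite mulfV//; lra.
have edl0 : 0 < e * dl by rewrite mulr_gt0.
pose sg : R := dl * e / (4 * (e + 1)).
have sg0 : 0 < sg by rewrite divr_gt0 ?mulr_gt0//; lra.
have sgE : 4 * (e + 1) * sg = dl * e by rewrite mulrC divfK//; lra.
have esg0 : 0 < e * sg by rewrite mulr_gt0.
pose M : R := e + 1 + dl^-1.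
have dlV0 : 0 < dl^-1 by rewrite invr_gt0.
have M0 : 0 < M by rewrite /M; lra.
(* Outside the cone, [M] bounds N p ^+ 2 by a multiple of |v|^2, and [T] then yields the hypothesis
   [B <= sg ^+ 2 * A] of the equator case. Inside it, [16 * T <= 1] gives [8 * |q.2| <= |p.2|]. *)
pose T : R := e * sg ^+ 2 / (16 * M).
have T0 : 0 < T by apply: divr_gt0; apply: mulr_gt0 => //; exact: exprn_gt0.
have TE : 16 * M * T = e * sg ^+ 2 by rewrite mulrC divfK//; lra.
have sg1 : 2 * sg <= 1 by lra.
have sg2 : sg ^+ 2 <= 1 by rewrite expr_le1 ?ltW//; lra.
have T16 : 16 * T <= 1.
  have : 16 * M * T <= M by rewrite TE /M; nra.
  by rewrite mulrAC -[leRHS]mul1r ler_pM2r.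
pose kp : R := e / (4 * (e + 1)).
have kp0 : 0 < kp by rewrite divr_gt0//; lra.
have kpE : 4 * (e + 1) * kp = e by rewrite mulrC divfK//; lra.
have ekp0 : 0 < e * kp by rewrite mulr_gt0.
(* The gauge takes the height as 4 z, whence the factor 4. *)
exists (4 * dl), kp, T; split => //; first by rewrite T0; lra.
move=> p q; have [_ Zp Np] := eps_norm_sqr_bounds p.
have [Bq Zq _] := eps_norm_sqr_bounds q.
have A0 := dot_ge0 p.1; have B0 := dot_ge0 q.1.
rewrite -/e in Zp Np Bq Zq.
move=> pq sgnpq s0 ts far.
rewrite -(@ler_pXn2r _ 2) ?nnegrE ?eps_norm_ge0// eps_dist_sqr eps_norm_sqr -/e.
have stE : (2 * dot p.1 q.1) ^+ 2 + (2 * symp p.1 q.1) ^+ 2 =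
    4 * dot p.1 p.1 * dot q.1 q.1 by rewrite /dot /symp; ring.
have s20 : 0 <= 2 * dot p.1 q.1 by lra.
have tE : `|2 * symp p.1 q.1| = 2 * `|symp p.1 q.1|.
  by rewrite normrM ger0_norm.
have ks : 4 * (kp * dot p.1 q.1) <= e * dot p.1 q.1.
  by rewrite mulrA ler_wpM2r//; lra.
have ks1 : kp * dot p.1 q.1 <= dot p.1 q.1 
  by apply: ler_piMl => //; rewrite ler_pdivrMr; lra.
have es0 : 0 <= e * dot p.1 q.1 by rewrite mulr_ge0// ltW.
set A := dot p.1 p.1 in Np A0 pq stE *.
set B := dot q.1 q.1 in Bq B0 pq stE *.
set s := dot p.1 q.1 in s0 ts stE s20 ks ks1 es0 *.
set t := symp p.1 q.1 in ts stE tE *.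
set n2 := N p ^+ 2 in Zp Np far *.
set m2 := N q ^+ 2 in Bq Zq far *.
have [pole|equator] := boolP (A <= 4 * dl * `|p.2|).
  have poleq : B <= 4 * dl * `|q.2| by rewrite -pq.
  have n2Z : n2 <= 8 * `|p.2|.
    have : (e + 1) * A <= (e + 1) * (4 * dl * `|p.2|) by rewrite ler_wpM2l//; lra.
    have : (e + 1) * dl * (4 * `|p.2|) <= 1 * (4 * `|p.2|).
      by rewrite ler_wpM2r ?mulr_ge0//; lra.
    lra.
  have UZ : 8 * `|q.2| <= `|p.2|.
    have : T * n2 <= T * (8 * `|p.2|) by rewrite ler_wpM2l// ltW.
    have : 16 * T * `|p.2| <= 1 * `|p.2| by rewrite ler_wpM2r.
    lra.
  have [z0|z0] := leP 0 p.2.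
    have u0 : 0 <= q.2 by rewrite -sgnpq.
    move: pole poleq UZ; rewrite !ger0_norm// => pole poleq UZ.
    by apply: (@gauge_step_pole _ _ dl) => //; rewrite ?tE; lra.
  have u0 : q.2 < 0 by rewrite ltNge -sgnpq -ltNge.
  move: pole poleq UZ; rewrite !ltr0_norm// => pole poleq UZ.
  (* The gauge is even in the height: reflect both points to positive heights. *)
  rewrite -gaugeN -[leRHS]gaugeN.
  rewrite (_ : - (_ - _ + _) = - (4 * p.2) - - (4 * q.2) + - (2 * t)); last by ring.
  apply: (@gauge_step_pole _ _ dl) => //; rewrite ?sqrrN ?normrN ?tE; lra.
have equatorq : 4 * dl * `|q.2| < B by rewrite ltNge -pq.
rewrite -ltNge in equator.
have ZA : 4 * `|p.2| <= dl^-1 * A by rewrite ler_pdivlMl//; lra.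
have n2A : n2 <= M * A by rewrite /M; lra.
have BA : e * B <= e * (sg ^+ 2 * A).
  have h1 : T * n2 <= T * (M * A) by rewrite ler_wpM2l// ltW.
  have h2 : 16 * M * T * A = e * sg ^+ 2 * A by rewrite TE.
  have h3 : 0 <= T * (M * A).
    by do 2 (apply: mulr_ge0; rewrite ?(ltW T0) ?(ltW M0)//).
  lra.
rewrite ler_pM2l// in BA.
apply: (@gauge_step_equator _ _ dl sg) => //; rewrite ?tE; try lra.
by rewrite normrM ger0_norm//; lra.
Qed.

(** * Points at comparable scales *)

Lemma eps_dist_dil (a b : R) p : 0 <= b <= a ->
  d (heis_dil a p) (heis_dil b p) ^+ 2 <= (a ^+ 2 - b ^+ 2) * N p ^+ 2.
Proof.
move=> /andP[b0 ba]; have a0 := le_trans b0 ba.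
have ab0 : 0 <= a ^+ 2 - b ^+ 2 by rewrite subr_ge0 lerXn2r ?nnegrE.
rewrite !eps_norm_sqr /gauge [leRHS]mulrDr; set A := dot p.1 p.1.
have A0 : 0 <= A by exact: dot_ge0.
rewrite (_ : dot _ _ = (a - b) ^+ 2 * A); last by rewrite /A /dot /=; ring.
have le_ab : (a - b) ^+ 2 * A <= (a ^+ 2 - b ^+ 2) * A.
  by rewrite ler_wpM2r//; nra.
apply: lerD; first by rewrite [leRHS]mulrCA ler_wpM2l// sqr_ge0.
rewrite (_ : 4 * _ = - ((a ^+ 2 - b ^+ 2) * (4 * p.2))); last first.
  by rewrite /= /symp /=; field.
rewrite -enorm_dil//=.
have enorm_abs (x y : R) : enorm (x, `|y|) = enorm (x, y).
  by rewrite /enorm /= real_normK ?num_real.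
rewrite -enorm_abs normrN -[leRHS]enorm_abs; apply: enorm_le => /=.
  by rewrite le_ab andbT mulr_ge0 ?sqr_ge0.
by rewrite normr_ge0 lexx.
Qed.

(** Go from p to q through the dilate of p that has the norm m of q. With n the norm of p, the first
    leg is at most sqrt(n^2 - m^2) <= n (1 - T / 2), the second at most n T / 2. *)
Lemma eps_dist_near T p q : 0 < T <= 1 -> 0 < N q <= N p ->
  T * N p ^+ 2 <= N q ^+ 2 ->
  2 * d (heis_dil (N p)^-1 p) (heis_dil (N q)^-1 q) <= T -> d p q <= N p.
Proof.
set n := N p; set m := N q => /andP[T0 T1] /andP[m0 mn] Tn.
have n0 : 0 < n by exact: lt_le_trans mn.
have n_ge0 := ltW n0; have m_ge0 := ltW m0.
set p' := heis_dil n^-1 p; set q' := heis_dil m^-1 q => dpq.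
have dilK (a : R) (r : heis R) : 0 < a -> heis_dil a (heis_dil a^-1 r) = r.
  move=> a0; case: r => [[x y] z]; rewrite /heis_dil /=.
  by congr ((_, _), _); field; rewrite gt_eqF.
have pE : p = heis_dil n p' by rewrite dilK.
have qE : q = heis_dil m q' by rewrite dilK.
have Np' : N p' = 1.
  by rewrite eps_norm_dil ?invr_ge0 ?ltW// mulVf// gt_eqF.
have d2 : d (heis_dil m p') q <= n * (T / 2).
  rewrite qE eps_dist_homogeneous//; apply: ler_pM => //.
  - exact: eps_norm_ge0.
  - lra.
have d1 : d p (heis_dil m p') <= n * (1 - T / 2).
  have : d p (heis_dil m p') ^+ 2 <= n ^+ 2 - m ^+ 2.
    rewrite [in leLHS]pE -[leRHS]mulr1 -(expr1n _ 2) -Np'.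
    by apply: eps_dist_dil; rewrite m_ge0.
  move=> h; rewrite -(@ler_pXn2r _ 2) ?nnegrE ?eps_norm_ge0//; last first.
    by rewrite mulr_ge0//; lra.
  apply: le_trans h _; rewrite exprMn.
  have : n ^+ 2 * (1 - T) <= n ^+ 2 * (1 - T / 2) ^+ 2.
    by rewrite ler_wpM2l ?sqr_ge0//; have := sqr_ge0 (T / 2); nra.
  lra.
apply: le_trans (norm_dist_triangle (@eps_normD R eps) (heis_dil m p') _ _) _.
by apply: le_trans (lerD d1 d2) _; lra.
Qed.

(** On bounded sets, coordinate closeness controls the distance. The bound is linear in [h] for the
    squared distance, because height differences enter it to the first power. *)
Lemma eps_dist_close L h p q : 0 <= h <= 1 ->
  `|p.1.1| <= L -> `|p.1.2| <= L ->
  `|p.1.1 - q.1.1| <= h -> `|p.1.2 - q.1.2| <= h -> `|p.2 - q.2| <= h ->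
  d p q ^+ 2 <= h * (2 * eps ^+ 2 + 6 + 4 * L).
Proof.
move=> /andP[h0 h1] v1 v2 x1 x2 x3; rewrite eps_dist_sqr /gauge.
have -> : dot p.1 p.1 + dot q.1 q.1 - 2 * dot p.1 q.1 =
    (p.1.1 - q.1.1) ^+ 2 + (p.1.2 - q.1.2) ^+ 2 by rewrite /dot; ring.
have -> : 4 * p.2 - 4 * q.2 + 2 * symp p.1 q.1 = 4 * (p.2 - q.2) -
    2 * (p.1.1 * (p.1.2 - q.1.2)) + 2 * (p.1.2 * (p.1.1 - q.1.1)).
  by rewrite /symp; ring.
move: (p.1.1 - q.1.1) (p.1.2 - q.1.2) (p.2 - q.2) x1 x2 x3 => x y z x1 x2 x3.
have sq (r : R) : `|r| <= h -> r ^+ 2 <= h.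
  move=> rh; rewrite -(real_normK (num_real r)) expr2.
  by rewrite -[leRHS]mulr1 ler_pM// (le_trans rh).
have := sq x x1; have := sq y x2 => y2 x2'.
have mul (a b : R) : `|a| <= L -> `|b| <= h -> `|a * b| <= L * h.
  by move=> aL bh; rewrite normrM ler_pM.
have m1 := mul _ _ v1 x2; have m2 := mul _ _ v2 x1.
have X0 : 0 <= x ^+ 2 + y ^+ 2 by rewrite addr_ge0 ?sqr_ge0.
have := enorm_le_norm (4 * z - 2 * (p.1.1 * y) + 2 * (p.1.2 * x)) X0.
have : `|4 * z - 2 * (p.1.1 * y) + 2 * (p.1.2 * x)| <= 4 * h + 4 * (L * h).
  move: x3 m1 m2; rewrite !ler_norml => /andP[? ?] /andP[? ?] /andP[? ?].
  by apply/andP; split; lra.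
have : eps ^+ 2 * (x ^+ 2 + y ^+ 2) <= eps ^+ 2 * (2 * h).
  by rewrite ler_wpM2l ?sqr_ge0//; lra.
lra.
Qed.

(** For unit vectors within [k] in each coordinate, the inner product is at least 1/2 and the area
    form at most [2 * k]. *)
Lemma angle_close k kp v w : 0 <= k -> 2 * k <= 1 -> 4 * k <= kp ->
  `|v.1 / enorm v - w.1 / enorm w| <= k ->
  `|v.2 / enorm v - w.2 / enorm w| <= k ->
  0 <= dot v w /\ `|symp v w| <= kp * dot v w.
Proof.
move=> k0 k2 kkp.
(* A zero vector has no direction, but both forms vanish on it. *)
have [/enorm0->|v0] := eqVneq (enorm v) 0.
  by rewrite /dot /symp /= !mul0r subr0 addr0 normr0 mulr0.
have [/enorm0->|w0] := eqVneq (enorm w) 0.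
  by rewrite /dot /symp /= !mulr0 subr0 addr0 normr0 mulr0.
have := enorm_sqr v; have := enorm_sqr w.
have := enorm_ge0 v; have := enorm_ge0 w.
case: v w v0 w0 => [v1 v2] [w1 w2]; rewrite /dot /symp /=.
set a := enorm (v1, v2); set b := enorm (w1, w2) => an0 bn0 b0 a0 bE aE.
set c1 := v1 / a; set c2 := v2 / a; set d1 := w1 / b; set d2 := w2 / b.
have v1E : v1 = a * c1 by rewrite mulrC divfK.
have v2E : v2 = a * c2 by rewrite mulrC divfK.
have w1E : w1 = b * d1 by rewrite mulrC divfK.
have w2E : w2 = b * d2 by rewrite mulrC divfK.
have cE : c1 ^+ 2 + c2 ^+ 2 = 1.
  by rewrite /c1 /c2 !expr_div_n -mulrDl -aE mulfV// sqrf_eq0.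
have dE : d1 ^+ 2 + d2 ^+ 2 = 1.
  by rewrite /d1 /d2 !expr_div_n -mulrDl -bE mulfV// sqrf_eq0.
clearbody c1 c2 d1 d2 => h1 h2.
have -> : v1 * w1 + v2 * w2 = a * b * (c1 * d1 + c2 * d2).
  by rewrite v1E v2E w1E w2E; ring.
have -> : v1 * w2 - v2 * w1 = a * b * (c2 * (c1 - d1) - c1 * (c2 - d2)).
  by rewrite v1E v2E w1E w2E; ring.
have ab0 : 0 <= a * b by exact: mulr_ge0.
have sq (r : R) : `|r| <= k -> r ^+ 2 <= k / 2.
  move=> rk; rewrite -(real_normK (num_real r)) expr2.
  by apply: ler_pM => //; lra.
have cd : 2^-1 <= c1 * d1 + c2 * d2.
  by have := sq _ h1; have := sq _ h2; nra.
have le1 (r r' : R) : r ^+ 2 + r' ^+ 2 = 1 -> `|r| <= 1.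
  move=> rr'; rewrite -(@ler_pXn2r _ 2) ?nnegrE// real_normK ?num_real// expr1n.
  by have := sqr_ge0 r'; lra.
have c1l := le1 _ _ cE; rewrite addrC in cE; have c2l := le1 _ _ cE.
split; first by rewrite mulr_ge0//; lra.
rewrite normrM (ger0_norm ab0) mulrCA ler_wpM2l//.
have l1 := ler_pM (normr_ge0 _) (normr_ge0 _) c2l h1.
have l2 := ler_pM (normr_ge0 _) (normr_ge0 _) c1l h2.
rewrite -!normrM in l1 l2.
apply: le_trans (ler_normB _ _) _.
have : 4 * k * 2^-1 <= kp * (c1 * d1 + c2 * d2) by apply: ler_pM => //; lra.
lra.
Qed.

(** * Finite coloring and the covering property *)

Lemma eps_norm1_bounds p : N p = 1 ->
  [/\ `|p.1.1| <= eps^-1, `|p.1.2| <= eps^-1 & `|p.2| <= 1].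
Proof.
move=> Np; have [h1 h2 _] := eps_norm_sqr_bounds p.
rewrite Np expr1n /dot -!expr2 in h1 h2.
have aux (x y : R) : eps ^+ 2 * (x ^+ 2 + y ^+ 2) <= 1 -> `|x| <= eps^-1.
  move=> hxy; have ex := mulr_ge0 (ltW eps0) (normr_ge0 x).
  rewrite -(ler_pM2l eps0) divff ?gt_eqF// -(@ler_pXn2r _ 2) ?nnegrE//.
  rewrite expr1n exprMn real_normK ?num_real//.
  by have := mulr_ge0 (sqr_ge0 eps) (sqr_ge0 y); lra.
split; [exact: aux h1 | by apply: (aux _ p.1.1); rewrite addrC |].
by have := normr_ge0 p.2; lra.
Qed.

Lemma normalized_coord_le1 v : `|v.1 / enorm v| <= 1 /\ `|v.2 / enorm v| <= 1.
Proof.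
have [->|v0] := eqVneq (enorm v) 0; first by rewrite invr0 !mulr0 normr0.
have vp : 0 < enorm v by rewrite lt_neqAle eq_sym v0 enorm_ge0.
have aux (x y : R) : x ^+ 2 + y ^+ 2 = enorm v ^+ 2 -> `|x / enorm v| <= 1.
  move=> xy; rewrite normrM normfV (ger0_norm (ltW vp)) ler_pdivrMr// mul1r.
  rewrite -(@ler_pXn2r _ 2) ?nnegrE ?enorm_ge0// real_normK ?num_real// -xy.
  by rewrite lerDl sqr_ge0.
split; [apply: (aux _ v.2) | apply: (aux _ v.1)]; rewrite enorm_sqr//.
exact: addrC.
Qed.

Lemma interval_coloring (a h : R) : 0 < h -> exists (n : nat) (c : R -> 'I_n.+1),
  forall x y, `|x| <= a -> `|y| <= a -> c x = c y -> `|x - y| <= h.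
Proof.
move=> h0; pose f (x : R) := Num.trunc ((x + a) / h).
(* The color is the index of the cell of length [h] containing [x], counted from [- a]; [inord]
   gives a meaningless color outside the interval. *)
exists (Num.trunc (2 * a / h)), (fun x => inord (f x)) => x y xa ya.
have fP (z : R) : `|z| <= a -> (f z < (Num.trunc (2 * a / h)).+1)%N /\
    (f z)%:R * h <= z + a < ((f z)%:R + 1) * h.
  rewrite ler_norml => /andP[az za].
  have z0 : 0 <= (z + a) / h by apply: divr_ge0; [lra | exact: ltW].
  split.
    by rewrite ltnS le_truncn// ler_pM2r ?invr_gt0//; lra.
  have := truncn_itv z0.
  by rewrite -natr1 ler_pdivlMr// ltr_pdivrMr.
have [fx1 /andP[fx2 fx3]] := fP x xa; have [fy1 /andP[fy2 fy3]] := fP y ya.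
move=> /(congr1 val); rewrite /= !inordK// => fxy; rewrite fxy in fx2 fx3.
by rewrite ler_norml; apply/andP; split; lra.
Qed.

(** The color records membership in the cone, the sign of the height, and the cells of the
    normalized point and of the horizontal direction: the data that the far and near cases
    compare. *)
Lemma eps_coloring : exists (V : finType) (c : heis R -> V),
  forall p q, c p = c q -> d p q <= Num.max (N p) (N q).
Proof.
have [dl [kp [T [kp0 T01 far]]]] := eps_dist_far.
have /andP[T0 T1] := T01.
pose L := eps^-1 + 1; have L0 : 0 < eps^-1 by rewrite invr_gt0.
pose M := 2 * eps ^+ 2 + 6 + 4 * L.
have e0 := sqr_ge0 eps.
have M0 : 0 < M by rewrite /M /L; lra.
(* The first two bounds serve [angle_close]; the third makes normalized points of one color at most
   [T / 2] apart. *)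
pose h := Num.min (Num.min (2^-1) (kp / 4)) ((T / 2) ^+ 2 / M).
have h0 : 0 < h.
  rewrite /h !lt_min invr_gt0 ltr0n divr_gt0//=.
  by apply: divr_gt0 => //; apply/exprn_gt0/divr_gt0.
have [h2 hkp hM] : [/\ 2 * h <= 1, 4 * h <= kp & h * M <= (T / 2) ^+ 2].
  have : h <= h by []; rewrite {2}/h !le_min -andbA => /and3P[a1 a2 a3].
  by split; [lra | lra | rewrite -ler_pdivlMr].
have [n [c cP]] := interval_coloring L h0.
pose nrm p := heis_dil (N p)^-1 p.
exists (bool * bool * ('I_n.+1 * 'I_n.+1 * 'I_n.+1) * ('I_n.+1 * 'I_n.+1))%type.
exists (fun p => (dot p.1 p.1 <= dl * `|p.2|, 0 <= p.2,
  (c (nrm p).1.1, c (nrm p).1.2, c (nrm p).2),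
  (c (p.1.1 / enorm p.1), c (p.1.2 / enorm p.1)))).
move=> p q; wlog : p q / N q <= N p.
  move=> wl pq; have [qp|/ltW pq'] := leP (N q) (N p).
    by rewrite -[leRHS](max_idPl qp); exact: wl.
  by rewrite eps_distC -[leRHS](max_idPl pq'); exact: wl.
move=> qp [polepq sgnpq c1 c2 c3 c4 c5]; rewrite (max_idPl qp).
(* The origin cannot be normalized, but its distance to p is N p. *)
have [/eps_norm_eq0 ->|q0] := eqVneq (N q) 0.
  by rewrite eps_distC /eps_dist heis_inv0 heis_mul0p.
have Nq0 : 0 < N q by rewrite lt_neqAle eq_sym q0 eps_norm_ge0.
have Np0 := lt_le_trans Nq0 qp.
have [p4 p5] := normalized_coord_le1 p.1.
have [q4 q5] := normalized_coord_le1 q.1.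
have le1L (x : R) : x <= 1 -> x <= L by rewrite /L; lra.
have leVL (x : R) : x <= eps^-1 -> x <= L by rewrite /L; lra.
have [s0 ts] : 0 <= dot p.1 q.1 /\ `|symp p.1 q.1| <= kp * dot p.1 q.1.
  by apply: (@angle_close h) => //; [exact: ltW|apply: cP => //; exact: le1L..].
have [le_T|/ltW lt_T] := leP (N q ^+ 2) (T * N p ^+ 2); first exact: far.
apply: (@eps_dist_near T) => //; first by rewrite Nq0.
have nrm1 r : 0 < N r -> N (nrm r) = 1.
  by move=> r0; rewrite eps_norm_dil ?invr_ge0 ?ltW// mulVf ?gt_eqF.
have [p1 p2 p3] := eps_norm1_bounds (nrm1 _ Np0).
have [q1 q2 q3] := eps_norm1_bounds (nrm1 _ Nq0).
have close : d (nrm p) (nrm q) ^+ 2 <= (T / 2) ^+ 2.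
  apply: le_trans hM; apply: eps_dist_close.
  - by rewrite ltW//=; lra.
  - exact: leVL.
  - exact: leVL.
  - by apply: cP => //; exact: leVL.
  - by apply: cP => //; exact: leVL.
  - by apply: cP => //; exact: le1L.
rewrite ler_pXn2r ?nnegrE ?eps_norm_ge0// in close.
  by rewrite /nrm in close; lra.
by rewrite divr_ge0 ?ltW.
Qed.

(** Translate a common point of the balls to the origin, so that each radius is at least the norm of
    the center. Of two distinct balls whose centers share a color, one would contain the center of
    the other. *)
Lemma eps_BCP : BCP (heis_eps eps).
Proof.
have [V [c cP]] := eps_coloring.
(* The successor keeps the constant at least 1. *)
exists #|V|.+1 => // F [F0 Fsep [x Fx]].
pose rel (B : heis_eps eps * R) : heis R := heis_mul (heis_inv x) B.1.
have relE B B' : d (rel B) (rel B') = d B.1 B'.1.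
  exact: eps_dist_left_invariant.
have rel_le B : F B -> N (rel B) <= B.2.
  by move=> FB; have := Fx B FB; rewrite /cball/= mdist_epsE eps_distC.
have g_inj : {in F &, injective (fun B => val (enum_rank (c (rel B))))}.
  move=> B B' /set_mem FB /set_mem FB' /val_inj/enum_rank_inj /cP.
  rewrite relE => h; apply: contrapT => BB'.
  have nB := Fsep _ _ FB FB' (nesym BB').
  have nB' := Fsep _ _ FB' FB BB'.
  move: h; rewrite le_max => /orP[h|h].
    by apply: nB'; rewrite /cball/= mdist_epsE (le_trans h)// rel_le.
  by apply: nB; rewrite /cball/= mdist_epsE eps_distC (le_trans h)// rel_le.
rewrite -(card_le_eql (inj_card_eq g_inj)); apply: subset_card_le.
by move=> _ [B FB <-] /=; rewrite ltnS ltnW.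
Qed.

End EpsilonDistance.

Theorem theorem1p9 (R : realType) :
  (forall eps : R, 0 < eps -> BCP (heis_eps eps)) /\ ~ BCP (heis_koranyi R).
Proof. by split=> [eps|]; [exact: eps_BCP | exact: koranyi_not_BCP]. Qed.
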